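(* Let $S$ be a complete semiring, $(\mathbf{C},\otimes,I)$ a small strict monoidal category, and $\mathcal{F}$ a system of fields. Let $\phi:M\to N$ be any homeomorphism of closed $n$-manifolds. Then the induced isomorphism $\phi_*:E(M)\to E(N)$ of pre-state modules restricts to an isomorphism $\phi_*:Z(M)\to Z(N)$ of state modules.
   Context: A semiring $(S,+,\cdot,0,1)$ consists of a commutative monoid $(S,+,0)$ and a (not necessarily commutative) monoid $(S,\cdot,1)$ such that $\cdot$ distributes over $+$ from both sides and $0$ is absorbing. A complete monoid is a commutative monoid $(M,+,0)$ with a summation law assigning to every family $(m_i)_{i\in I}$, $I$ an arbitrary set, an element $\sum_{i\in I}m_i$ such that $\sum_{i\in\varnothing}m_i=0$, $\sum_{i\in\{1\}}m_i=m_1$, $\sum_{i\in\{1,2\}}m_i=m_1+m_2$, and $\sum_{j\in J}\big(\sum_{i\in I_j}m_i\big)=\sum_{i\in I}m_i$ for every partition $I=\bigcup_{j\in J}I_j$. A semiring is complete if $(S,+,0,\sum)$ is a complete monoid and $\sum_i ss_i=s\sum_i s_i$, $\sum_i s_is=(\sum_i s_i)s$. $Q=Q_S(\mathbf{C})$ is the complete monoid of functions $\operatorname{Mor}(\mathbf{C})\to S$ with pointwise addition and summation. It carries two complete semiring structures: $Q^c=(Q,+,\cdot,0,1)$ with $(a\cdot b)(\gamma)=\sum_{\beta\circ\alpha=\gamma}b(\beta)a(\alpha)$ and $1$ the characteristic function of the set of identity morphisms; $Q^m=(Q,+,\times,0,1^\times)$ with $(a\times b)(\gamma)=\sum_{\alpha\otimes\beta=\gamma}b(\beta)a(\alpha)$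 and $1^\times$ the characteristic function of $\operatorname{id}_I$. A two-sided $R$-semialgebra ($R$ a semiring) is a semiring $A$ which is also an $R$-$R$-bisemimodule with $r(ab)=(ra)b$ and $(ab)r=a(br)$; morphisms are semiring morphisms that are also bisemimodule homomorphisms. For a set $A$, the set $\operatorname{Fun}_Q(A)$ of functions $A\to Q$ with pointwise operations and scalar multiplications is a two-sided $Q^c$-semialgebra (using $\cdot$) and a two-sided $Q^m$-semialgebra (using $\times$). Fix an integer $n\ge 0$. Manifolds are topological and need not be orientable; $\varnothing$ is a manifold of every dimension; $\sqcup$ is the ordered disjoint union. A bordism from $M$ to $N$ is a triple $(W,M,N)$ (often abbreviated $W$) with $W$ a compact $(n+1)$-dimensional topological manifold, $\partial W=M\sqcup N$, where the closed $n$-manifolds $M,N$ are the incoming and outgoing boundary. $(W,M,N)\sqcup(W',M',N')=(W\sqcup W',M\sqcup M',N\sqcup N')$. If $W'$ is a bordism from $M$ to $N$ and $W''$ a bordism from $N$ to $P$, gluing along $N$ yields the bordism $W'\cup_N W''$ from $M$ to $P$. A homeomorphism of bordisms is a homeomorphism preserving incoming and outgoing boundaries. $(W_0,M_0,N_0)$ is a subbordism of $(W,M,N)$ if $W_0\subset W$ is a codimension $0$ submanifold, every connected component $C$ of $M_0$ satisfies $C\cap\partial W=\varnothing$ or $C\subset M$, and every connected component $C$ of $N_0$ satisfies $C\cap\partial W=\varnothing$ or $C\subset N$. A system $\mathcal{F}$ of fields assigns to each bordism $W$ a set $\mathcal{F}(W)$ and to each closed $n$-manifold $M$ a set $\mathcal{F}(M)$,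 with $\mathcal{F}(\varnothing)$ a one-element set, such that: (FRES) There are restriction maps $\mathcal{F}(W)\to\mathcal{F}(W_0)$ for subbordisms $W_0\subset W$, $\mathcal{F}(M)\to\mathcal{F}(M_0)$ for codimension $0$ submanifolds $M_0\subset M$, and $\mathcal{F}(W)\to\mathcal{F}(M)$ for closed codimension $1$ submanifolds $M\subset W$; they are written $f\mapsto f|_{(-)}$ and commute with each other in the obvious way (restricting in stages equals restricting directly). (FHOMEO) A homeomorphism of bordisms $\phi:W\to W'$ induces a bijection $\phi^*:\mathcal{F}(W')\to\mathcal{F}(W)$ with $(\operatorname{id}_W)^*=\operatorname{id}$, $(\psi\circ\phi)^*=\phi^*\circ\psi^*$; similarly for homeomorphisms of closed $n$-manifolds; these maps commute with the restriction maps. (FDISJ) The products of restrictions $\mathcal{F}(W\sqcup W')\to\mathcal{F}(W)\times\mathcal{F}(W')$ and $\mathcal{F}(M\sqcup N)\to\mathcal{F}(M)\times\mathcal{F}(N)$ are bijections. (FGLUE) For $W=W'\cup_N W''$, the map $\mathcal{F}(W)\to\mathcal{F}(W')\times_{\mathcal{F}(N)}\mathcal{F}(W'')$ given by the restrictions to $W'$ and $W''$ is a bijection onto the pullback. For a closed $n$-manifold $M$, the pre-state module is $E(M)=\operatorname{Fun}_Q(\mathcal{F}(M))$ and the state module is $Z(M)=\{z\in E(M)\mid z(\phi^*f)=z(f)$ for all $f\in\mathcal{F}(M)$ and all homeomorphisms $\phi:M\to M$ isotopic to the identity$\}$ (an isotopy is a homotopy through homeomorphisms); both are two-sided $Q^c$-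 and $Q^m$-semialgebras with pointwise operations. A homeomorphism $\phi:M\to N$ of closed $n$-manifolds induces the isomorphism of two-sided $Q^c$- and $Q^m$-semialgebras $\phi_*:E(M)\to E(N)$, $\phi_*(z)(g)=z(\phi^*g)$ for $g\in\mathcal{F}(N)$. *)

(* Defs.v *)
From HB Require Import structures.
From mathcomp Require Import all_boot all_order all_algebra.
From mathcomp Require Import all_classical reals topology normedtype.
Import Order.TTheory GRing.Theory Num.Theory.
Import numFieldNormedType.Exports.

Set Implicit Arguments.
Unset Strict Implicit.
Unset Printing Implicit Defensive.

Local Open Scope classical_set_scope.
Local Open Scope ring_scope.

(* The index sets {} , {1} and {1,2} of the summation axioms are taken up to
   bijection; a partition of [I] indexed by [J] is given by the map
   [p : I -> J] whose fibres are its blocks (blocks may be empty). *)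
HB.mixin Record Nmodule_isComplete M of GRing.Nmodule M := {
  csum : forall I : Type, (I -> M) -> M;
  csum_empty : forall (I : Type) (m : I -> M), (I -> False) -> csum I m = 0;
  csum_single : forall (I : Type) (m : I -> M) (i : I),
    (forall k, k = i) -> csum I m = m i;
  csum_pair : forall (I : Type) (m : I -> M) (i j : I),
    i <> j -> (forall k, k = i \/ k = j) -> csum I m = m i + m j;
  csum_partition : forall (I J : Type) (p : I -> J) (m : I -> M),
    csum J (fun j => csum {i : I | p i = j} (fun i => m (sval i))) = csum I m
}.

#[short(type="completeNmodType")]
HB.structure Definition CompleteNmodule :=
  {M of Nmodule_isComplete M & GRing.Nmodule M}.

Arguments csum {s I} m.
Arguments csum_empty {s I}.
Arguments csum_single {s I m} i.
Arguments csum_pair {s I m} i j.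
Arguments csum_partition {s I J} p m.

HB.mixin Record PzSemiRing_isComplete S
    of GRing.PzSemiRing S & CompleteNmodule S := {
  csumMl : forall (I : Type) (s : S) (m : I -> S),
    csum (fun i => s * m i) = s * csum m;
  csumMr : forall (I : Type) (s : S) (m : I -> S),
    csum (fun i => m i * s) = csum m * s
}.

#[short(type="completePzSemiRingType")]
HB.structure Definition CompletePzSemiRing :=
  {S of PzSemiRing_isComplete S & GRing.PzSemiRing S & CompleteNmodule S}.

Section CompleteMonoidTheory.
Context {M : completeNmodType}.

Lemma eq_csum (I : Type) (f g : I -> M) : f =1 g -> csum f = csum g.
Proof. by move=> /funext ->. Qed.

Lemma csum_bij (I J : Type) (h : I -> J) (m : J -> M) :
  injective h -> (forall j, exists i, h i = j) ->
  csum (fun i => m (h i)) = csum m.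
Proof.
move=> hI hS; rewrite -(csum_partition h); apply: eq_csum => j.
have [i hi] := hS j.
rewrite (csum_single (exist (fun i => h i = j) i hi)) /= ?hi //.
by case=> k hk; apply: eq_exist; apply: hI; rewrite hk hi.
Qed.

Lemma csum_reindex (I J : Type) (h : I -> J) (k : J -> I) (m : J -> M) :
  cancel h k -> cancel k h -> csum (fun i => m (h i)) = csum m.
Proof.
move=> hK kK; apply: csum_bij; first exact: can_inj hK.
by move=> j; exists (k j).
Qed.

Lemma csum_sigT (I : Type) (K : I -> Type) (m : forall i, K i -> M) :
  csum (fun i => csum (m i)) = csum (fun x : {i & K i} => m (projT1 x) (projT2 x)).
Proof.
rewrite -[RHS](csum_partition (@projT1 I K)); apply: eq_csum => i.
pose h (k : K i) : {x : {i & K i} | projT1 x = i} := exist _ (existT K i k) erefl.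
pose g (y : {x : {i & K i} | projT1 x = i}) : K i :=
  ecast j (K j) (proj2_sig y) (projT2 (sval y)).
have hK : cancel h g by move=> k.
have gK : cancel g h.
  by move=> [[j k] e]; rewrite /h /g /= in e * => {h g hK}; case: i / e.
by rewrite -(csum_reindex _ hK gK).
Qed.

Lemma csum_exchange (I J : Type) (m : I -> J -> M) :
  csum (fun i => csum (m i)) = csum (fun j => csum (fun i => m i j)).
Proof.
rewrite !csum_sigT.
pose h (x : {_ : I & J}) : {_ : J & I} := existT _ (projT2 x) (projT1 x).
pose k (x : {_ : J & I}) : {_ : I & J} := existT _ (projT2 x) (projT1 x).
by rewrite -(@csum_reindex _ _ h k) // => -[].
Qed.

Lemma csum0 (I : Type) : csum (fun _ : I => 0 : M) = 0.
Proof.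
rewrite -[RHS](csum_empty (fun _ : False => 0 : M) id).
rewrite -(csum_partition (fun x : False => match x return I with end)).
by apply: eq_csum => i; rewrite csum_empty //; case.
Qed.

Lemma csumD (I : Type) (f g : I -> M) :
  csum (fun i => f i + g i) = csum f + csum g.
Proof.
pose m (b : bool) i := if b then f i else g i.
rewrite -[f]/(m true) -[g]/(m false).
rewrite -(csum_pair (m := fun b => csum (m b)) true false) //; last by case; [left|right].
rewrite csum_exchange; apply: eq_csum => i.
by rewrite (csum_pair true false) //; case; [left|right].
Qed.

Lemma csum1 (I : Type) (i : I) (m : I -> M) :
  (forall k, k <> i -> m k = 0) -> csum m = m i.
Proof.
move=> m0; rewrite -(csum_partition (fun k => `[< k = i >])).
rewrite (csum_pair true false) //; last by case; [left|right].
rewrite [X in _ + X](_ : _ = 0) ?addr0.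
  have ii : `[< i = i >] = true by apply/asboolP.
  rewrite (csum_single (exist (fun k => `[< k = i >] = true) i ii)) //.
  by case=> k ki; apply: eq_exist; apply/asboolP.
rewrite -[RHS](csum0 {k | `[< k = i >] = false}); apply: eq_csum => -[k /= ki].
by apply: m0 => e; move/asboolP: e; rewrite ki.
Qed.

End CompleteMonoidTheory.

Arguments csum1 {M I} i {m}.
Arguments csum0 {M} I.

(* MathComp's left semialgebras cannot serve as a base here: they exclude the
   zero semiring and have no right action. *)
HB.mixin Record Nmodule_isBiSemiModule (R : pzSemiRingType) V
    of GRing.Nmodule V := {
  lscale : R -> V -> V;
  rscale : V -> R -> V;
  lscaleA : forall a b v, lscale a (lscale b v) = lscale (a * b) v;
  rscaleA : forall v a b, rscale (rscale v a) b = rscale v (a * b);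
  lscale_rscaleA : forall a v b, rscale (lscale a v) b = lscale a (rscale v b);
  lscale1 : left_id 1 lscale;
  rscale1 : right_id 1 rscale;
  lscaleDr : right_distributive lscale +%R;
  rscaleDl : left_distributive rscale +%R;
  lscaleDl : forall v, {morph lscale^~ v : a b / a + b};
  rscaleDr : forall v, {morph rscale v : a b / a + b};
  lscale0 : forall v, lscale 0 v = 0;
  rscale0 : forall v, rscale v 0 = 0;
  lscaler0 : forall a, lscale a 0 = 0;
  rscale0r : forall a, rscale 0 a = 0
}.

#[short(type="biSemiModType")]
HB.structure Definition BiSemiModule (R : pzSemiRingType) :=
  {V of Nmodule_isBiSemiModule R V & GRing.Nmodule V}.

HB.mixin Record BiSemiModule_isBiSemiAlgebra (R : pzSemiRingType) A
    of GRing.PzSemiRing A & BiSemiModule R A := {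
  lscaleAl : forall (r : R) (a b : A), lscale r (a * b) = lscale r a * b;
  rscaleAr : forall (a b : A) (r : R), rscale (a * b) r = a * rscale b r
}.

#[short(type="biSemiAlgType")]
HB.structure Definition BiSemiAlgebra (R : pzSemiRingType) :=
  {A of BiSemiModule_isBiSemiAlgebra R A & GRing.PzSemiRing A
      & BiSemiModule R A}.

Record biSemiAlg_morphism (R : pzSemiRingType) (A B : biSemiAlgType R)
    (f : A -> B) : Prop := BiSemiAlgMorphism {
  bsam_nmod : nmod_morphism f;
  bsam_monoid : monoid_morphism f;
  bsam_lscale : forall (r : R) (a : A), f (lscale r a) = lscale r (f a);
  bsam_rscale : forall (a : A) (r : R), f (rscale a r) = rscale (f a) r
}.

Definition biSemiAlg_isomorphism (R : pzSemiRingType) (A B : biSemiAlgType R)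
    (f : A -> B) : Prop :=
  biSemiAlg_morphism f /\
  exists g : B -> A, [/\ biSemiAlg_morphism g, cancel f g & cancel g f].

Definition funSA (A T : Type) : Type := A -> T.

Section FunSA.
Context (A : Type) (R : pzSemiRingType).
Implicit Types f g h : funSA A R.

HB.instance Definition _ := GRing.Nmodule.copy (funSA A R) (A -> R).

Let one : funSA A R := fun=> 1.
Let mul f g : funSA A R := fun x => f x * g x.
Let lscale (r : R) f : funSA A R := fun x => r * f x.
Let rscale f (r : R) : funSA A R := fun x => f x * r.

Let mulA : associative mul.
Proof. by move=> f g h; apply/funext => x; rewrite /mul mulrA. Qed.
Let mul1f : left_id one mul.
Proof. by move=> f; apply/funext => x; rewrite /mul mul1r. Qed.
Let mulf1 : right_id one mul.
Proof. by move=> f; apply/funext => x; rewrite /mul mulr1. Qed.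
Let mulDl : left_distributive mul +%R.
Proof. by move=> f g h; apply/funext => x; exact: mulrDl. Qed.
Let mulDr : right_distributive mul +%R.
Proof. by move=> f g h; apply/funext => x; exact: mulrDr. Qed.
Let mul0f : left_zero 0 mul.
Proof. by move=> f; apply/funext => x; exact: mul0r. Qed.
Let mulf0 : right_zero 0 mul.
Proof. by move=> f; apply/funext => x; exact: mulr0. Qed.

HB.instance Definition _ := GRing.Nmodule_isPzSemiRing.Build (funSA A R)
  mulA mul1f mulf1 mulDl mulDr mul0f mulf0.

Let lscaleA a b f : lscale a (lscale b f) = lscale (a * b) f.
Proof. by apply/funext => x; exact: mulrA. Qed.
Let rscaleA f a b : rscale (rscale f a) b = rscale f (a * b).
Proof. by apply/funext => x; rewrite /rscale mulrA. Qed.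
Let lscale_rscaleA a f b : rscale (lscale a f) b = lscale a (rscale f b).
Proof. by apply/funext => x; rewrite /lscale /rscale mulrA. Qed.
Let lscale1 : left_id 1 lscale.
Proof. by move=> f; apply/funext => x; exact: mul1r. Qed.
Let rscale1 : right_id 1 rscale.
Proof. by move=> f; apply/funext => x; exact: mulr1. Qed.
Let lscaleDr : right_distributive lscale +%R.
Proof. by move=> a f g; apply/funext => x; exact: mulrDr. Qed.
Let rscaleDl : left_distributive rscale +%R.
Proof. by move=> f g a; apply/funext => x; exact: mulrDl. Qed.
Let lscaleDl f : {morph lscale^~ f : a b / a + b}.
Proof. by move=> a b; apply/funext => x; exact: mulrDl. Qed.
Let rscaleDr f : {morph rscale f : a b / a + b}.
Proof. by move=> a b; apply/funext => x; exact: mulrDr. Qed.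
Let lscale0 f : lscale 0 f = 0.
Proof. by apply/funext => x; exact: mul0r. Qed.
Let rscale0 f : rscale f 0 = 0.
Proof. by apply/funext => x; exact: mulr0. Qed.
Let lscaler0 a : lscale a 0 = 0.
Proof. by apply/funext => x; exact: mulr0. Qed.
Let rscale0r a : rscale 0 a = 0.
Proof. by apply/funext => x; exact: mul0r. Qed.

HB.instance Definition _ := Nmodule_isBiSemiModule.Build R (funSA A R)
  lscaleA rscaleA lscale_rscaleA lscale1 rscale1 lscaleDr rscaleDl
  lscaleDl rscaleDr lscale0 rscale0 lscaler0 rscale0r.

Let lscaleAl (r : R) f g : lscale r (f * g) = lscale r f * g.
Proof. by apply/funext => x; exact: mulrA. Qed.
Let rscaleAr f g (r : R) : rscale (f * g) r = f * rscale g r.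
Proof. by apply/funext => x; symmetry; exact: mulrA. Qed.

HB.instance Definition _ := BiSemiModule_isBiSemiAlgebra.Build R (funSA A R)
  lscaleAl rscaleAr.

End FunSA.

Lemma funSA_morphism (A B : Type) (R : pzSemiRingType) (h : B -> A) :
  biSemiAlg_morphism (fun z : funSA A R => (z \o h : funSA B R)).
Proof. by split. Qed.

Lemma funSA_isomorphism (A B : Type) (R : pzSemiRingType) (h : B -> A) :
  bijective h -> biSemiAlg_isomorphism (fun z : funSA A R => (z \o h : funSA B R)).
Proof.
move=> [k hK kK]; split; first exact: funSA_morphism.
exists (fun z => z \o k); split; first exact: funSA_morphism.
  by move=> z; apply/funext => x /=; rewrite kK.
by move=> z; apply/funext => x /=; rewrite hK.
Qed.

(* Composition and tensor product of the morphisms of a strict monoidal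
   category are both partial monoids on the set of all morphisms.
   [pm_rel b a c] reads: the product of [b] and [a] is defined and equals [c]. *)
Record partialMonoid (X : Type) := PartialMonoid {
  pm_rel : X -> X -> X -> Prop;
  pm_unit : X -> Prop;
  pm_fun : forall b a c c', pm_rel b a c -> pm_rel b a c' -> c = c';
  pm_assoc : forall c b a x,
    (exists2 u, pm_rel b a u & pm_rel c u x) <->
    (exists2 v, pm_rel c b v & pm_rel v a x);
  pm_unitl : forall x, exists u, [/\ pm_unit u, pm_rel u x x &
    forall v a, pm_unit v -> pm_rel v a x -> v = u /\ a = x];
  pm_unitr : forall x, exists u, [/\ pm_unit u, pm_rel x u x &
    forall v a, pm_unit v -> pm_rel a v x -> v = u /\ a = x]
}.

(* The argument [pm] only serves to select the multiplication. *)
Definition convQ (S : completePzSemiRingType) (X : Type)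
  (pm : partialMonoid X) : Type := X -> S.

Section ConvolutionSemiring.
Context (S : completePzSemiRingType) (X : Type) (pm : partialMonoid X).
Implicit Types (a b c : convQ S pm) (x y z : X).

HB.instance Definition _ := GRing.Nmodule.copy (convQ S pm) (X -> S).

Let conv_csum (I : Type) (m : I -> convQ S pm) : convQ S pm :=
  fun x => csum (fun i => m i x).

Let conv_csum_empty I (m : I -> convQ S pm) : (I -> False) -> conv_csum m = 0.
Proof. by move=> I0; apply/funext => x; rewrite /conv_csum csum_empty. Qed.

Let conv_csum_single I (m : I -> convQ S pm) i :
  (forall k, k = i) -> conv_csum m = m i.
Proof. by move=> I1; apply/funext => x; rewrite /conv_csum (csum_single i). Qed.

Let conv_csum_pair I (m : I -> convQ S pm) i j :
  i <> j -> (forall k, k = i \/ k = j) -> conv_csum m = m i + m j.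
Proof. by move=> ij I2; apply/funext => x; rewrite /conv_csum (csum_pair i j). Qed.

Let conv_csum_partition I J (p : I -> J) (m : I -> convQ S pm) :
  conv_csum (fun j : J => conv_csum (fun i : {i : I | p i = j} => m (sval i)))
  = conv_csum m.
Proof.
by apply/funext => x; exact: (csum_partition p (fun i => m i x)).
Qed.

HB.instance Definition _ := Nmodule_isComplete.Build (convQ S pm)
  conv_csum_empty conv_csum_single conv_csum_pair conv_csum_partition.

Let one : convQ S pm := fun x => if `[< pm_unit pm x >] then 1 else 0.

Let mul a b : convQ S pm := fun x =>
  csum (fun p : {p : X * X | pm_rel pm p.1 p.2 x} =>
    b (sval p).1 * a (sval p).2).

Let mulA : associative mul.
Proof.
move=> a b c; apply/funext => x; rewrite /mul.
pose T := {t : X * X * X |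
  exists2 u, pm_rel pm t.1.2 t.2 u & pm_rel pm t.1.1 u x}.
pose m (t : T) := c (sval t).1.1 * b (sval t).1.2 * a (sval t).2.
transitivity (csum m).
  under eq_csum => p do rewrite -csumMr.
  rewrite csum_sigT.
  pose A := {p : {p : X * X | pm_rel pm p.1 p.2 x} &
             {q : X * X | pm_rel pm q.1 q.2 (sval p).1}}.
  have hT (q : A) : exists2 u, pm_rel pm (sval (projT2 q)).2
      (sval (projT1 q)).2 u & pm_rel pm (sval (projT2 q)).1 u x.
    apply/pm_assoc; exists (sval (projT1 q)).1; first exact: svalP (projT2 q).
    exact: svalP (projT1 q).
  pose h (q : A) : T := exist (fun t : X * X * X =>
    exists2 u, pm_rel pm t.1.2 t.2 u & pm_rel pm t.1.1 u x)
    (sval (projT2 q), (sval (projT1 q)).2) (hT q).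
  rewrite -(@csum_bij _ _ _ h m) //.
    move=> [[[z1 x1] /= p1] [[w1 y1] /= q1]] [[[z2 x2] /= p2] [[w2 y2] /= q2]].
    move=> [e1 e2 e3]; move: p1 q1 p2 q2; rewrite e1 e2 e3 => p1 q1 p2 q2.
    have e := pm_fun q1 q2; case: _ / e p2 q2 => p2 q2.
    by rewrite (Prop_irrelevance p1 p2) (Prop_irrelevance q1 q2).
  move=> [[[w y] x'] /= t].
  have [v Pv Px] := (pm_assoc pm _ _ _ _).1 t.
  exists (existT (fun p : {p : X * X | pm_rel pm p.1 p.2 x} =>
               {q : X * X | pm_rel pm q.1 q.2 (sval p).1})
    (exist (fun p : X * X => pm_rel pm p.1 p.2 x) (v, x') Px)
    (exist (fun q : X * X => pm_rel pm q.1 q.2 v) (w, y) Pv)).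
  exact: eq_exist.
under [RHS]eq_csum => p do rewrite -csumMl.
rewrite csum_sigT.
pose A := {p : {p : X * X | pm_rel pm p.1 p.2 x} &
           {q : X * X | pm_rel pm q.1 q.2 (sval p).2}}.
have hT (q : A) : exists2 u, pm_rel pm (sval (projT2 q)).1
    (sval (projT2 q)).2 u & pm_rel pm (sval (projT1 q)).1 u x.
  exists (sval (projT1 q)).2; first exact: svalP (projT2 q).
  exact: svalP (projT1 q).
pose h (q : A) : T := exist (fun t : X * X * X =>
  exists2 u, pm_rel pm t.1.2 t.2 u & pm_rel pm t.1.1 u x)
  ((sval (projT1 q)).1, (sval (projT2 q)).1, (sval (projT2 q)).2) (hT q).
rewrite -(@csum_bij _ _ _ h m).
- by apply: eq_csum => q; rewrite /m /= mulrA.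
- move=> [[[w1 u1] /= p1] [[y1 x1] /= q1]] [[[w2 u2] /= p2] [[y2 x2] /= q2]].
  move=> [e1 e2 e3]; move: p1 q1 p2 q2; rewrite e1 e2 e3 => p1 q1 p2 q2.
  have e := pm_fun q1 q2; case: _ / e p2 q2 => p2 q2.
  by rewrite (Prop_irrelevance p1 p2) (Prop_irrelevance q1 q2).
- move=> [[[w y] x'] /= [u Pu Px]].
  exists (existT (fun p : {p : X * X | pm_rel pm p.1 p.2 x} =>
               {q : X * X | pm_rel pm q.1 q.2 (sval p).2})
    (exist (fun p : X * X => pm_rel pm p.1 p.2 x) (w, u) Px)
    (exist (fun q : X * X => pm_rel pm q.1 q.2 u) (y, x') Pu)).
  exact: eq_exist.
Qed.

Let mul1c : left_id one mul.
Proof.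
move=> a; apply/funext => x; rewrite /mul.
have [u [Uu Px Pu]] := pm_unitr pm x.
rewrite (csum1 (exist (fun p : X * X => pm_rel pm p.1 p.2 x) (x, u) Px)) /=.
  by rewrite /one asboolT // mulr1.
move=> [[y v] /= Pyv] ne; rewrite /one; case: asboolP => [Uv|_]; last first.
  by rewrite mulr0.
by have [? ?] := Pu _ _ Uv Pyv; subst; case: ne; exact: eq_exist.
Qed.

Let mulc1 : right_id one mul.
Proof.
move=> a; apply/funext => x; rewrite /mul.
have [u [Uu Px Pu]] := pm_unitl pm x.
rewrite (csum1 (exist (fun p : X * X => pm_rel pm p.1 p.2 x) (u, x) Px)) /=.
  by rewrite /one asboolT // mul1r.
move=> [[v y] /= Pvy] ne; rewrite /one; case: asboolP => [Uv|_]; last first.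
  by rewrite mul0r.
by have [? ?] := Pu _ _ Uv Pvy; subst; case: ne; exact: eq_exist.
Qed.

Let mulDl : left_distributive mul +%R.
Proof.
move=> a b c; apply/funext => x; rewrite -[RHS]csumD.
by apply: eq_csum => p; exact: mulrDr.
Qed.

Let mulDr : right_distributive mul +%R.
Proof.
move=> a b c; apply/funext => x; rewrite -[RHS]csumD.
by apply: eq_csum => p; exact: mulrDl.
Qed.

Let mul0c : left_zero 0 mul.
Proof.
move=> a; apply/funext => x; rewrite -[RHS](csum0 {p : X * X | pm_rel pm p.1 p.2 x}).
by apply: eq_csum => p; exact: mulr0.
Qed.

Let mulc0 : right_zero 0 mul.
Proof.
move=> a; apply/funext => x; rewrite -[RHS](csum0 {p : X * X | pm_rel pm p.1 p.2 x}).
by apply: eq_csum => p; exact: mul0r.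
Qed.

HB.instance Definition _ := GRing.Nmodule_isPzSemiRing.Build (convQ S pm)
  mulA mul1c mulc1 mulDl mulDr mul0c mulc0.

Let conv_csumMl I a (m : I -> convQ S pm) :
  csum (fun i => a * m i) = a * csum m.
Proof.
apply/funext => x; rewrite -[LHS]csum_exchange.
by apply: eq_csum => p; rewrite csumMr.
Qed.

Let conv_csumMr I a (m : I -> convQ S pm) :
  csum (fun i => m i * a) = csum m * a.
Proof.
apply/funext => x; rewrite -[LHS]csum_exchange.
by apply: eq_csum => p; rewrite csumMl.
Qed.

HB.instance Definition _ := PzSemiRing_isComplete.Build (convQ S pm)
  conv_csumMl conv_csumMr.

End ConvolutionSemiring.

Record strictMonoidalCat := StrictMonoidalCat {
  ob : Type;
  mor : Type;
  src : mor -> ob;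
  tgt : mor -> ob;
  idm : ob -> mor;
  comp : forall g f : mor, src g = tgt f -> mor;  (* g after f *)
  src_idm : forall x, src (idm x) = x;
  tgt_idm : forall x, tgt (idm x) = x;
  src_comp : forall g f (e : src g = tgt f), src (comp e) = src f;
  tgt_comp : forall g f (e : src g = tgt f), tgt (comp e) = tgt g;
  comp_idl : forall f (e : src (idm (tgt f)) = tgt f), comp e = f;
  comp_idr : forall f (e : src f = tgt (idm (src f))), comp e = f;
  comp_assoc : forall h g f (hg : src h = tgt g) (gf : src g = tgt f)
    (h_gf : src h = tgt (comp gf)) (hg_f : src (comp hg) = tgt f),
    comp h_gf = comp hg_f;
  tob : ob -> ob -> ob;
  tmor : mor -> mor -> mor;
  tunit : ob;
  src_tmor : forall f g, src (tmor f g) = tob (src f) (src g);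
  tgt_tmor : forall f g, tgt (tmor f g) = tob (tgt f) (tgt g);
  tmor_idm : forall x y, tmor (idm x) (idm y) = idm (tob x y);
  tmor_comp : forall g f g' f' (e : src g = tgt f) (e' : src g' = tgt f')
    (et : src (tmor g g') = tgt (tmor f f')),
    tmor (comp e) (comp e') = comp et;
  tobA : associative tob;
  tob1 : left_id tunit tob;
  tob1r : right_id tunit tob;
  tmorA : associative tmor;
  tmor1 : left_id (idm tunit) tmor;
  tmor1r : right_id (idm tunit) tmor
}.

Section CategorySemirings.
Context (S : completePzSemiRingType) (C : strictMonoidalCat).

Let comp_rel (b a c : mor C) := exists e : src b = tgt a, comp e = c.
Let comp_unit (a : mor C) := exists x, a = idm x.

Let comp_fun b a c c' : comp_rel b a c -> comp_rel b a c' -> c = c'.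
Proof. by case=> e <- [e' <-]; congr comp; exact: Prop_irrelevance. Qed.

Let comp_relA c b a x :
  (exists2 u, comp_rel b a u & comp_rel c u x) <->
  (exists2 v, comp_rel c b v & comp_rel v a x).
Proof.
split=> [[u [e eu] [f fx]]|[v [e ev] [f fx]]].
  subst u; have e' : src c = tgt b by rewrite f tgt_comp.
  have f' : src (comp e') = tgt a by rewrite src_comp.
  exists (comp e'); first by exists e'.
  by exists f'; rewrite -fx; symmetry; exact: comp_assoc.
subst v; have e' : src b = tgt a by rewrite -f src_comp.
have f' : src c = tgt (comp e') by rewrite tgt_comp.
exists (comp e'); first by exists e'.
by exists f'; rewrite -fx; exact: comp_assoc.
Qed.

Let comp_unitl x : exists u, [/\ comp_unit u, comp_rel u x x &
  forall v a, comp_unit v -> comp_rel v a x -> v = u /\ a = x].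
Proof.
exists (idm (tgt x)); split; first by exists (tgt x).
  by exists (src_idm (tgt x)); exact: comp_idl.
move=> v a [y ->] [e ex]; move: (e); rewrite src_idm => ey; subst y.
by move: ex; rewrite comp_idl => <-.
Qed.

Let comp_unitr x : exists u, [/\ comp_unit u, comp_rel x u x &
  forall v a, comp_unit v -> comp_rel a v x -> v = u /\ a = x].
Proof.
exists (idm (src x)); split; first by exists (src x).
  by exists (esym (tgt_idm (src x))); exact: comp_idr.
move=> v a [y ->] [e ex]; move: (e); rewrite tgt_idm => ey; subst y.
by move: ex; rewrite comp_idr => <-.
Qed.

Definition comp_pm : partialMonoid (mor C) :=
  PartialMonoid comp_fun comp_relA comp_unitl comp_unitr.

(* The order is reversed here: the factor [a] tensored with [b] contributes the
   coefficient [b(beta) * a(alpha)]. *)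
Let tens_rel (b a c : mor C) := tmor a b = c.
Let tens_unit (a : mor C) := a = idm (tunit C).

Let tens_fun b a c c' : tens_rel b a c -> tens_rel b a c' -> c = c'.
Proof. by move=> <-. Qed.

Let tens_relA c b a x :
  (exists2 u, tens_rel b a u & tens_rel c u x) <->
  (exists2 v, tens_rel c b v & tens_rel v a x).
Proof.
split=> [[u <- <-]|[v <- <-]].
  by exists (tmor b c) => //; rewrite /tens_rel tmorA.
by exists (tmor a b) => //; rewrite /tens_rel tmorA.
Qed.

Let tens_unitl x : exists u, [/\ tens_unit u, tens_rel u x x &
  forall v a, tens_unit v -> tens_rel v a x -> v = u /\ a = x].
Proof.
exists (idm (tunit C)); split=> //; first exact: tmor1r.
by move=> v a -> <-; rewrite tmor1r.
Qed.

Let tens_unitr x : exists u, [/\ tens_unit u, tens_rel x u x &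
  forall v a, tens_unit v -> tens_rel a v x -> v = u /\ a = x].
Proof.
exists (idm (tunit C)); split=> //; first exact: tmor1.
by move=> v a -> <-; rewrite tmor1.
Qed.

Definition tens_pm : partialMonoid (mor C) :=
  PartialMonoid tens_fun tens_relA tens_unitl tens_unitr.

Definition Q : Type := mor C -> S.
Definition Qc : completePzSemiRingType := convQ S comp_pm.
Definition Qm : completePzSemiRingType := convQ S tens_pm.

Lemma Qc_mulE (a b : Qc) (gamma : mor C) : (a * b) gamma =
  csum (fun p : {p : mor C * mor C | exists e : src p.1 = tgt p.2, comp e = gamma} =>
    b (sval p).1 * a (sval p).2).
Proof. by []. Qed.

Lemma Qc_oneE (gamma : mor C) :
  (1 : Qc) gamma = if `[< exists x, gamma = idm x >] then 1 else 0.
Proof. by []. Qed.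

Lemma Qm_mulE (a b : Qm) (gamma : mor C) : (a * b) gamma =
  csum (fun p : {p : mor C * mor C | tmor p.2 p.1 = gamma} =>
    b (sval p).1 * a (sval p).2).
Proof. by []. Qed.

Lemma Qm_oneE (gamma : mor C) :
  (1 : Qm) gamma = if `[< gamma = idm (tunit C) >] then 1 else 0.
Proof. by []. Qed.

End CategorySemirings.

Record homeo (X Y : topologicalType) := Homeo {
  homeo_fun :> X -> Y;
  homeo_inv : Y -> X;
  homeo_funK : cancel homeo_fun homeo_inv;
  homeo_invK : cancel homeo_inv homeo_fun;
  homeo_continuous : continuous homeo_fun;
  homeo_inv_continuous : continuous homeo_inv
}.

Definition homeo_id (X : topologicalType) : homeo X X :=
  @Homeo X X id id (fun=> erefl) (fun=> erefl) (fun=> cvg_id) (fun=> cvg_id).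

Section HomeoOps.
Context {X Y Z : topologicalType}.

Definition homeo_comp (psi : homeo Y Z) (phi : homeo X Y) : homeo X Z :=
  @Homeo X Z (psi \o phi) (homeo_inv phi \o homeo_inv psi)
    (can_comp (homeo_funK psi) (homeo_funK phi))
    (can_comp (homeo_invK phi) (homeo_invK psi))
    (fun x => continuous_comp (@homeo_continuous _ _ phi x)
                              (@homeo_continuous _ _ psi (phi x)))
    (fun z => continuous_comp (@homeo_inv_continuous _ _ psi z)
                              (@homeo_inv_continuous _ _ phi (homeo_inv psi z))).

Definition homeo_sym (phi : homeo X Y) : homeo Y X :=
  @Homeo Y X (homeo_inv phi) phi (@homeo_invK _ _ phi) (@homeo_funK _ _ phi)
    (@homeo_inv_continuous _ _ phi) (@homeo_continuous _ _ phi).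

End HomeoOps.

(* A homeomorphism onto the image. *)
Definition embedding (X Y : topologicalType) (j : X -> Y) : Prop :=
  [/\ injective j, continuous j &
      forall U : set X, open U -> exists2 V : set Y, open V & U = j @^-1` V].

Section Charts.
Context (R : realType).

(* [x] has an open neighbourhood homeomorphic to [V]. *)
Definition chart_at (m : nat) (V : set 'rV[R]_m) (X : topologicalType) (x : X) :=
  exists phi : V -> X, [/\ embedding phi, open (range phi) & range phi x].

Definition euclidean_at (m : nat) (X : topologicalType) (x : X) : Prop :=
  exists2 V : set 'rV[R]_m, open V & chart_at V x.

Definition half_space (m : nat) : set 'rV[R]_m.+1 :=
  [set v | 0 <= v ord0 ord0].

(* This is the local condition for manifolds of dimension [m.+1]. *)
Definition half_euclidean_at (m : nat) (X : topologicalType) (x : X) : Prop :=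
  exists2 O : set 'rV[R]_m.+1, open O & chart_at (O `&` @half_space m) x.

(* Points without a neighbourhood homeomorphic to an open subset of R^m; no
   choice of charts is involved. *)
Definition mboundary (m : nat) (X : topologicalType) : set X :=
  [set x | ~ euclidean_at m x].
Arguments mboundary m X : clear implicits.

Record closedManifold (n : nat) := ClosedManifold {
  cm_space :> topologicalType;
  cm_hausdorff : hausdorff_space cm_space;
  cm_countable : @second_countable cm_space;
  cm_compact : compact [set: cm_space];
  cm_euclidean : forall x : cm_space, euclidean_at n x
}.

(* The identification of the boundary of the bordism with the disjoint union
   of [M] and [N] is part of the data. *)
Record bordism (n : nat) (M N : closedManifold n) := Bordism {
  b_space :> topologicalType;
  b_hausdorff : hausdorff_space b_space;
  b_countable : @second_countable b_space;
  b_compact : compact [set: b_space];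
  b_euclidean : forall x : b_space, half_euclidean_at n x;
  b_in : M -> b_space;
  b_out : N -> b_space;
  b_in_embedding : embedding b_in;
  b_out_embedding : embedding b_out;
  b_disjoint : range b_in `&` range b_out = set0;
  b_boundary : range b_in `|` range b_out = mboundary n.+1 b_space
}.

End Charts.

Arguments mboundary R m X : clear implicits.

Lemma embedding_comp (X Y Z : topologicalType) (g : Y -> Z) (f : X -> Y) :
  embedding g -> embedding f -> embedding (g \o f).
Proof.
move=> [gi gc go] [fi fc fo]; split; first exact: inj_comp.
  by move=> x; apply: continuous_comp; [exact: fc|exact: gc].
move=> U /fo[V /go[W oW ->] ->]; by exists W.
Qed.

Section OpenEmbedding.
Context (R : realType) (X Y : topologicalType) (j : X -> Y).
Hypothesis j_emb : embedding j.
Hypothesis j_open : forall U : set X, open U -> open (j @` U).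

Lemma chart_at_image m (V : set 'rV[R]_m) (x : X) :
  chart_at V x -> chart_at V (j x).
Proof.
move=> [phi [phi_emb orphi [v _ vx]]]; exists (j \o phi); split.
- exact: embedding_comp.
- rewrite -(image_comp phi j); apply: j_open; exact: orphi.
- by exists v => //=; rewrite vx.
Qed.

Lemma euclidean_at_image m (x : X) :
  euclidean_at R m (j x) <-> euclidean_at R m x.
Proof.
have [ji jc jo] := j_emb.
split; last by move=> [V oV cV]; exists V => //; exact: chart_at_image.
move=> [V oV [phi [[phii phic phio] orphi [v0 _ v0x]]]].
have [O oO phiO] : exists2 O : set 'rV[R]_m, open O &
    phi @^-1` (range j) = set_val @^-1` O.
  have : open (phi @^-1` range j).
    by apply: open_comp => [v _|]; [exact: phic|exact/j_open/openT].
  by case=> O oO <-; exists O.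
pose V' := O `&` V.
have psiP (v' : V') : exists x, exists2 v : V, set_val v = set_val v' & phi v = j x.
  have [Ov Vv] := set_valP v'.
  have : (phi @^-1` range j) (SigSub (mem_set Vv)) by rewrite phiO.
  by case=> y _ jy; exists y, (SigSub (mem_set Vv)).
pose psi v' := projT1 (cid (psiP v')).
have psiE v' : exists2 v : V, set_val v = set_val v' & phi v = j (psi v').
  exact: projT2 (cid (psiP v')).
exists V'; first exact: openI.
exists psi; split.
- split.
  + move=> v1 v2 e; have [w1 e1 f1] := psiE v1; have [w2 e2 f2] := psiE v2.
    apply: val_inj; rewrite -!set_valE -e1 -e2; congr set_val; apply: phii.
    by rewrite f1 f2 e.
  + apply/continuousP => U oU.
    have : open (phi @^-1` (j @` U)).
      by apply: open_comp => [v _|]; [exact: phic|exact: j_open].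
    case=> O' oO' O'E; exists O' => //; apply/seteqP; split=> v' /=.
      have [w <- wE] := psiE v' => O'w.
      have : (phi @^-1` (j @` U)) w by rewrite -O'E.
      by case=> y Uy; rewrite wE => /ji <-.
    have [w <- wE] := psiE v' => Uv'.
    have : (phi @^-1` (j @` U)) w by exists (psi v').
    by rewrite -O'E.
  + move=> B [O' oO' <-].
    have [|W oW WE] := phio (set_val @^-1` O'); first by exists O'.
    exists (j @^-1` W); first by apply: open_comp => // v _; exact: jc.
    apply/seteqP; split=> v' /=; have [w <- wE] := psiE v'; rewrite -wE.
      by move=> O'w; have : (set_val @^-1` O') w by []; rewrite WE.
    by move=> Ww; have : (phi @^-1` W) w by []; rewrite -WE.
- have -> : range psi = j @^-1` range phi.
    apply/seteqP; split=> y.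
      by move=> [v' _ <-] /=; have [w _ wE] := psiE v'; exists w.
    move=> [w _ /= wE].
    have Ow : O (set_val w).
      by have : (phi @^-1` range j) w by [exists y]; rewrite phiO.
    exists (SigSub (mem_set (conj Ow (set_valP w)) : _ \in V')) => //.
    have [w' w'w w'E] := psiE (SigSub (mem_set (conj Ow (set_valP w)) : _ \in V')).
    apply: ji; rewrite -w'E -wE; congr phi; apply: val_inj; exact: w'w.
  by apply: open_comp => // v _; exact: jc.
- have Ow : O (set_val v0).
    by have : (phi @^-1` range j) v0 by [exists x]; rewrite phiO.
  exists (SigSub (mem_set (conj Ow (set_valP v0)) : _ \in V')) => //.
  have [w' w'w w'E] := psiE (SigSub (mem_set (conj Ow (set_valP v0)) : _ \in V')).
  apply: ji; rewrite -w'E -v0x; congr phi; apply: val_inj; exact: w'w.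
Qed.

End OpenEmbedding.

Definition dsum_fam (X Y : topologicalType) (b : bool) : topologicalType :=
  if b then X else Y.
Definition dsum (X Y : topologicalType) : topologicalType :=
  {b : bool & dsum_fam X Y b}.

Section DisjointUnion.
Context {X Y : topologicalType}.

Definition dinl (x : X) : dsum X Y := existT (dsum_fam X Y) true x.
Definition dinr (y : Y) : dsum X Y := existT (dsum_fam X Y) false y.

Lemma dinl_open (U : set X) : open U -> open (dinl @` U).
Proof. exact: (@existT_open_map _ (dsum_fam X Y) true). Qed.

Lemma dinr_open (U : set Y) : open U -> open (dinr @` U).
Proof. exact: (@existT_open_map _ (dsum_fam X Y) false). Qed.

Lemma dinl_inj : injective dinl.
Proof. by move=> x x' /(@existT_inj2 _ (dsum_fam X Y) true). Qed.

Lemma dinr_inj : injective dinr.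
Proof. by move=> y y' /(@existT_inj2 _ (dsum_fam X Y) false). Qed.

Lemma dinlr (x : X) (y : Y) : dinl x <> dinr y.
Proof. by move=> e; have := congr1 (@projT1 _ _) e. Qed.

Lemma dinl_continuous : continuous dinl.
Proof. exact: (@existT_continuous _ (dsum_fam X Y) true). Qed.

Lemma dinr_continuous : continuous dinr.
Proof. exact: (@existT_continuous _ (dsum_fam X Y) false). Qed.

Lemma dinl_embedding : embedding dinl.
Proof.
split; [exact: dinl_inj|exact: dinl_continuous|move=> U oU].
exists (dinl @` U); first exact: dinl_open.
by apply/seteqP; split=> [x Ux|x [x' Ux' /dinl_inj <-]] //; exists x.
Qed.

Lemma dinr_embedding : embedding dinr.
Proof.
split; [exact: dinr_inj|exact: dinr_continuous|move=> U oU].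
exists (dinr @` U); first exact: dinr_open.
by apply/seteqP; split=> [x Ux|x [x' Ux' /dinr_inj <-]] //; exists x.
Qed.

Lemma dsum_hausdorff :
  hausdorff_space X -> hausdorff_space Y -> hausdorff_space (dsum X Y).
Proof.
rewrite !open_hausdorff => hX hY.
have H (x : X) (y : Y) : exists2 AB : set (dsum X Y) * set (dsum X Y),
    (dinl x \in AB.1 /\ dinr y \in AB.2) &
    [/\ open AB.1, open AB.2 & AB.1 `&` AB.2 == set0].
  exists (range dinl, range dinr); first by rewrite !inE; split; [exists x|exists y].
  split; [exact/dinl_open/openT|exact/dinr_open/openT|].
  by apply/eqP/seteqP; split=> // z [[x' _ <-]] [y' _] /esym /dinlr.
case=> -[] x [] [] y xy.
- have /hX[[A B] /= [xA yB] [oA oB /eqP AB]] : x != y.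
    by apply: contra_neq xy => ->.
  exists (dinl @` A, dinl @` B) => /=.
    by rewrite !inE; split; [exists x|exists y] => //; exact/set_mem.
  split; [exact: dinl_open|exact: dinl_open|apply/eqP/seteqP; split=> // z].
  move=> [[a Aa <-]] [b Bb /dinl_inj ba].
  by have : (A `&` B) a by [split=> //; rewrite -ba]; rewrite AB.
- exact: H.
- have [[A B] [/= xA yB] [/= oA oB AB]] := H y x.
  by exists (B, A) => //; split=> //=; rewrite setIC.
- have /hY[[A B] /= [xA yB] [oA oB /eqP AB]] : x != y.
    by apply: contra_neq xy => ->.
  exists (dinr @` A, dinr @` B) => /=.
    by rewrite !inE; split; [exists x|exists y] => //; exact/set_mem.
  split; [exact: dinr_open|exact: dinr_open|apply/eqP/seteqP; split=> // z].
  move=> [[a Aa <-]] [b Bb /dinr_inj ba].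
  by have : (A `&` B) a by [split=> //; rewrite -ba]; rewrite AB.
Qed.

Lemma dsum_compact :
  compact [set: X] -> compact [set: Y] -> compact [set: dsum X Y].
Proof.
move=> cX cY; apply: (@sigT_compact _ (dsum_fam X Y)) => [|[]//].
exact: finite_finset.
Qed.

Lemma dsum_second_countable :
  @second_countable X -> @second_countable Y -> @second_countable (dsum X Y).
Proof.
move=> [A cA [oA bA]] [B cB [oB bB]].
exists ([set dinl @` U | U in A] `|` [set dinr @` U | U in B]).
  rewrite -bigcup2E; apply: bigcup_countable => // -[|[|]] //= _;
    exact: card_le_trans (card_image_le _ _) _.
split.
  move=> _ [[U /oA oU <-]|[U /oB oU <-]]; [exact: dinl_open|exact: dinr_open].
move=> [[] x] W.
- move=> /bA[U [AU Ux] UW]; exists (dinl @` U); last by move=> _ [y /UW ? <-].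
  by split; [left; exists U|exists x].
- move=> /bB[U [BU Ux] UW]; exists (dinr @` U); last by move=> _ [y /UW ? <-].
  by split; [right; exists U|exists x].
Qed.

End DisjointUnion.

Section DisjointUnionManifold.
Context {R : realType} {n : nat}.

Definition disj_manifold (M N : closedManifold R n) : closedManifold R n.
Proof.
refine (@ClosedManifold R n (dsum M N)
  (dsum_hausdorff (@cm_hausdorff _ _ M) (@cm_hausdorff _ _ N))
  (dsum_second_countable (@cm_countable _ _ M) (@cm_countable _ _ N))
  (dsum_compact (@cm_compact _ _ M) (@cm_compact _ _ N)) _).
case=> -[] x.
  exact: ((euclidean_at_image R dinl_embedding dinl_open n x).2 (cm_euclidean (x : M))).
exact: ((euclidean_at_image R dinr_embedding dinr_open n x).2 (cm_euclidean (x : N))).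
Defined.

Definition dsum_map (X Y X' Y' : topologicalType) (f : X -> X') (g : Y -> Y')
    (z : dsum X Y) : dsum X' Y' :=
  match z with
  | existT true x => dinl (f x)
  | existT false y => dinr (g y)
  end.

Lemma dsum_map_embedding (X Y X' Y' : topologicalType) (f : X -> X')
  (g : Y -> Y') : embedding f -> embedding g -> embedding (dsum_map f g).
Proof.
move=> [fi fc fo] [gi gc go]; split.
- case=> -[] x [] [] y /= => [/dinl_inj/fi -> //|/dinlr //|/esym/dinlr //|].
  by move=> /dinr_inj/gi ->.
- apply/continuousP => U oU; apply/sigT_openP => -[].
    apply: (@open_comp X (dsum X' Y') (dinl \o f)) => // x _.
    by apply: continuous_comp; [exact: fc|exact: dinl_continuous].
  apply: (@open_comp Y (dsum X' Y') (dinr \o g)) => // y _.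
  by apply: continuous_comp; [exact: gc|exact: dinr_continuous].
- move=> U oU.
  have [V1 oV1 V1E] : exists2 V1, open V1 & dinl @^-1` U = f @^-1` V1.
    by apply: fo; apply: open_comp => // x _; exact: dinl_continuous.
  have [V2 oV2 V2E] : exists2 V2, open V2 & dinr @^-1` U = g @^-1` V2.
    by apply: go; apply: open_comp => // y _; exact: dinr_continuous.
  exists (dinl @` V1 `|` dinr @` V2).
    by apply: openU; [exact: dinl_open|exact: dinr_open].
  apply/seteqP; split=> -[[] x] /=.
  + move=> Ux; left; exists (f x) => //.
    by have : (dinl @^-1` U) x by []; rewrite V1E.
  + move=> Uy; right; exists (g x) => //.
    by have : (dinr @^-1` U) x by []; rewrite V2E.
  + case=> -[z Vz]; last by move=> /esym/dinlr.
    by move=> /dinl_inj zE; have : (f @^-1` V1) x by [rewrite /= -zE]; rewrite -V1E.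
  + case=> -[z Vz]; first by move=> /dinlr.
    by move=> /dinr_inj zE; have : (g @^-1` V2) x by [rewrite /= -zE]; rewrite -V2E.
Qed.

Lemma dsum_map_range (X Y X' Y' : topologicalType) (f : X -> X')
    (g : Y -> Y') :
  range (dsum_map f g) = dinl @` range f `|` dinr @` range g.
Proof.
apply/seteqP; split=> z.
  by move=> [[[] x] _ <-]; [left; exists (f x)|right; exists (g x)].
move=> [[_ [x _ <-] <-]|[_ [y _ <-] <-]]; first by exists (dinl x).
by exists (dinr y).
Qed.

Lemma mboundary_dsum (m : nat) (X Y : topologicalType) :
  mboundary R m (dsum X Y) =
  dinl @` mboundary R m X `|` dinr @` mboundary R m Y.
Proof.
apply/seteqP; split=> [[[] x] bx|z [[x bx <-]|[x bx <-]]].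
- left; exists x => // ex; apply: bx.
  exact: ((euclidean_at_image R dinl_embedding dinl_open m x).2 ex).
- right; exists x => // ex; apply: bx.
  exact: ((euclidean_at_image R dinr_embedding dinr_open m x).2 ex).
- move=> ex; apply: bx.
  exact: ((euclidean_at_image R dinl_embedding dinl_open m x).1 ex).
- move=> ex; apply: bx.
  exact: ((euclidean_at_image R dinr_embedding dinr_open m x).1 ex).
Qed.

Definition disj_bordism (M N M' N' : closedManifold R n) (W : bordism M N)
  (W' : bordism M' N') : bordism (disj_manifold M M') (disj_manifold N N').
Proof.
refine (@Bordism R n (disj_manifold M M') (disj_manifold N N') (dsum W W')
  (dsum_hausdorff (@b_hausdorff _ _ _ _ W) (@b_hausdorff _ _ _ _ W'))
  (dsum_second_countable (@b_countable _ _ _ _ W) (@b_countable _ _ _ _ W'))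
  (dsum_compact (@b_compact _ _ _ _ W) (@b_compact _ _ _ _ W')) _
  (dsum_map (b_in W) (b_in W')) (dsum_map (b_out W) (b_out W'))
  (dsum_map_embedding (b_in_embedding W) (b_in_embedding W'))
  (dsum_map_embedding (b_out_embedding W) (b_out_embedding W')) _ _).
- case=> -[] x.
    have [O oO cO] := b_euclidean (x : W).
    by exists O => //; exact: (chart_at_image dinl_embedding dinl_open cO).
  have [O oO cO] := b_euclidean (x : W').
  by exists O => //; exact: (chart_at_image dinr_embedding dinr_open cO).
- rewrite !dsum_map_range; apply/seteqP; split=> // z.
  move=> [[[x xi <-]|[x xi <-]]] [[y yi]|[y yi]].
  + by move=> /dinl_inj yx; have : (range (b_in W) `&` range (b_out W)) x
      by [split=> //; rewrite -yx]; rewrite b_disjoint.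
  + by move=> /esym/dinlr.
  + by move=> /dinlr.
  + by move=> /dinr_inj yx; have : (range (b_in W') `&` range (b_out W')) x
      by [split=> //; rewrite -yx]; rewrite b_disjoint.
- have inE : mboundary R n.+1 W = range (b_in W) `|` range (b_out W).
    by rewrite b_boundary.
  have inE' : mboundary R n.+1 W' = range (b_in W') `|` range (b_out W').
    by rewrite b_boundary.
  rewrite !dsum_map_range mboundary_dsum inE inE' !image_setU.
  by rewrite setUACA.
Defined.

End DisjointUnionManifold.

(* Submanifolds are given by inclusion maps rather than by subsets, so that
   "restricting in stages" is restricting along a composite inclusion. The
   codimension is determined by the dimensions of [X] and [Y]. *)
Record submanifold (X Y : topologicalType) := Submanifold {
  sub_fun :> X -> Y;
  sub_embedding : embedding sub_fun
}.

Section Bordisms.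
Context {R : realType} {n : nat}.

Record subbordism (M0 N0 M N : closedManifold R n) (W0 : bordism M0 N0)
    (W : bordism M N) := Subbordism {
  sb_sub :> submanifold W0 W;
  sb_in : forall x : M0,
    let C := (sb_sub \o b_in W0) @` connected_component [set: M0] x in
    C `&` mboundary R n.+1 W = set0 \/ C `<=` range (b_in W);
  sb_out : forall y : N0,
    let C := (sb_sub \o b_out W0) @` connected_component [set: N0] y in
    C `&` mboundary R n.+1 W = set0 \/ C `<=` range (b_out W)
}.

Record bordismHomeo (M N M' N' : closedManifold R n) (W : bordism M N)
    (W' : bordism M' N') := BordismHomeo {
  bh_homeo :> homeo W W';
  bh_in : bh_homeo @` range (b_in W) = range (b_in W');
  bh_out : bh_homeo @` range (b_out W) = range (b_out W')
}.

Definition bordismHomeo_id (M N : closedManifold R n) (W : bordism M N) :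
    bordismHomeo W W :=
  @BordismHomeo _ _ _ _ W W (homeo_id W) (image_id _) (image_id _).

Section BordismHomeoComp.
Context (M N M' N' M'' N'' : closedManifold R n).
Context (W : bordism M N) (W' : bordism M' N') (W'' : bordism M'' N'').
Context (psi : bordismHomeo W' W'') (phi : bordismHomeo W W').

Let comp_in : homeo_comp psi phi @` range (b_in W) = range (b_in W'').
Proof. by rewrite -(bh_in psi) -(bh_in phi) [RHS]image_comp. Qed.

Let comp_out : homeo_comp psi phi @` range (b_out W) = range (b_out W'').
Proof. by rewrite -(bh_out psi) -(bh_out phi) [RHS]image_comp. Qed.

Definition bordismHomeo_comp : bordismHomeo W W'' :=
  BordismHomeo comp_in comp_out.

End BordismHomeoComp.

Definition in_sub (M N : closedManifold R n) (W : bordism M N) :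
  submanifold M W := Submanifold (b_in_embedding W).

Definition out_sub (M N : closedManifold R n) (W : bordism M N) :
  submanifold N W := Submanifold (b_out_embedding W).

Definition left_sub (M N : closedManifold R n) :
  submanifold M (disj_manifold M N) := Submanifold dinl_embedding.

Definition right_sub (M N : closedManifold R n) :
  submanifold N (disj_manifold M N) := Submanifold dinr_embedding.

Section DisjointSubbordisms.
Context (M N M' N' : closedManifold R n).
Context (W : bordism M N) (W' : bordism M' N').

Definition left_subbordism : subbordism W (disj_bordism W W').
Proof.
refine (@Subbordism _ _ _ _ W (disj_bordism W W')
  (Submanifold dinl_embedding) _ _) => x C; right=> _ [y _ <-].
  by exists (dinl y).
by exists (dinl y).
Defined.

Definition right_subbordism : subbordism W' (disj_bordism W W').
Proof.
refine (@Subbordism _ _ _ _ W' (disj_bordism W W')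
  (Submanifold dinr_embedding) _ _) => x C; right=> _ [y _ <-].
  by exists (dinr y).
by exists (dinr y).
Defined.

End DisjointSubbordisms.

(* The glued bordism is only determined up to homeomorphism, so gluing is a
   relation; as all spaces are compact Hausdorff, [W] necessarily carries the
   quotient topology. *)
Record gluing (M N P : closedManifold R n) (W' : bordism M N)
    (W'' : bordism N P) (W : bordism M P) := Gluing {
  gl_left : submanifold W' W;
  gl_right : submanifold W'' W;
  gl_cover : range gl_left `|` range gl_right = setT;
  gl_overlap : forall (x' : W') (x'' : W''), gl_left x' = gl_right x'' <->
    exists2 y : N, x' = b_out W' y & x'' = b_in W'' y;
  gl_in : forall x : M, b_in W x = gl_left (b_in W' x);
  gl_out : forall z : P, b_out W z = gl_right (b_out W'' z)
}.

Section GluingSubbordisms.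
Context (M N P : closedManifold R n).
Context (W' : bordism M N) (W'' : bordism N P) (W : bordism M P).
Context (g : gluing W' W'' W).

Let in_out (A B : closedManifold R n) (V : bordism A B) (a : A) (b : B) :
  b_in V a <> b_out V b.
Proof.
move=> e; have : (range (b_in V) `&` range (b_out V)) (b_in V a).
  by split; [exists a|exists b].
by rewrite b_disjoint.
Qed.

Let overlap (y : N) : gl_left g (b_out W' y) = gl_right g (b_in W'' y).
Proof. by apply/gl_overlap; exists y. Qed.

Let interior (y : N) : ~ mboundary R n.+1 W (gl_left g (b_out W' y)).
Proof.
rewrite -b_boundary => -[[x _]|[z _]].
  by rewrite (gl_in g); case: (sub_embedding (gl_left g)) => inj _ _ /inj/in_out.
rewrite (gl_out g) overlap.
by case: (sub_embedding (gl_right g)) => inj _ _ /inj/esym/in_out.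
Qed.

Definition gl_left_subbordism : subbordism W' W.
Proof.
refine (@Subbordism _ _ _ _ W' W (gl_left g) _ _) => x C.
  by right=> _ [y _ <-]; exists y => //; rewrite (gl_in g).
by left; apply/seteqP; split=> // _ [[y _ <-]] /interior.
Defined.

Definition gl_right_subbordism : subbordism W'' W.
Proof.
refine (@Subbordism _ _ _ _ W'' W (gl_right g) _ _) => x C.
  by left; apply/seteqP; split=> // _ [[y _ <-]] /=; rewrite -overlap => /interior.
by right=> _ [y _ <-]; exists y => //; rewrite (gl_out g).
Defined.

End GluingSubbordisms.

End Bordisms.

Section Fields.
Context (R : realType) (n : nat).
Notation manifold := (closedManifold R n).

Record fieldData := FieldData {
  bfield : forall M N : manifold, bordism M N -> Type;
  mfield : manifold -> Type;
  res_bb : forall (M0 N0 M N : manifold) (W0 : bordism M0 N0)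
    (W : bordism M N), subbordism W0 W -> bfield W -> bfield W0;
  res_mm : forall M0 M : manifold, submanifold M0 M -> mfield M -> mfield M0;
  res_bm : forall (M0 M N : manifold) (W : bordism M N),
    submanifold M0 W -> bfield W -> mfield M0;
  pull_b : forall (M N M' N' : manifold) (W : bordism M N)
    (W' : bordism M' N'), bordismHomeo W W' -> bfield W' -> bfield W;
  pull_m : forall M M' : manifold, homeo M M' -> mfield M' -> mfield M
}.

Arguments res_bb F {M0 N0 M N W0 W} j f : rename.
Arguments res_mm F {M0 M} j f : rename.
Arguments res_bm F {M0 M N W} j f : rename.
Arguments pull_b F {M N M' N' W W'} phi f : rename.
Arguments pull_m F {M M'} phi f : rename.

Record isFieldSystem (F : fieldData) : Prop := IsFieldSystem {
  mfield_empty : forall M : manifold, (M -> False) ->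
    exists! f : mfield F M, True;
  bfield_empty : forall (M N : manifold) (W : bordism M N), (W -> False) ->
    exists! f : bfield F W, True;

  res_bbb : forall (M1 N1 M0 N0 M N : manifold) (W1 : bordism M1 N1)
    (W0 : bordism M0 N0) (W : bordism M N) (j : subbordism W1 W0)
    (k : subbordism W0 W) (l : subbordism W1 W),
    (forall x, l x = k (j x)) ->
    forall f : bfield F W, res_bb F l f = res_bb F j (res_bb F k f);
  res_bbm : forall (M1 M0 N0 M N : manifold)
    (W0 : bordism M0 N0) (W : bordism M N) (j : submanifold M1 W0)
    (k : subbordism W0 W) (l : submanifold M1 W),
    (forall x, l x = k (j x)) ->
    forall f : bfield F W, res_bm F l f = res_bm F j (res_bb F k f);
  res_bmm : forall (M1 M0 M N : manifold) (W : bordism M N)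
    (j : submanifold M1 M0) (k : submanifold M0 W) (l : submanifold M1 W),
    (forall x, l x = k (j x)) ->
    forall f : bfield F W, res_bm F l f = res_mm F j (res_bm F k f);
  res_mmm : forall (M1 M0 M : manifold)
    (j : submanifold M1 M0) (k : submanifold M0 M) (l : submanifold M1 M),
    (forall x, l x = k (j x)) ->
    forall f : mfield F M, res_mm F l f = res_mm F j (res_mm F k f);

  pull_b_bij : forall (M N M' N' : manifold) (W : bordism M N)
    (W' : bordism M' N') (phi : bordismHomeo W W'), bijective (pull_b F phi);
  pull_b_id : forall (M N : manifold) (W : bordism M N) (f : bfield F W),
    pull_b F (bordismHomeo_id W) f = f;
  pull_b_comp : forall (M N M' N' M'' N'' : manifold) (W : bordism M N)
    (W' : bordism M' N') (W'' : bordism M'' N'') (psi : bordismHomeo W' W'')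
    (phi : bordismHomeo W W') (f : bfield F W''),
    pull_b F (bordismHomeo_comp psi phi) f = pull_b F phi (pull_b F psi f);
  pull_m_bij : forall (M M' : manifold) (phi : homeo M M'),
    bijective (pull_m F phi);
  pull_m_id : forall (M : manifold) (f : mfield F M),
    pull_m F (homeo_id M) f = f;
  pull_m_comp : forall (M M' M'' : manifold) (psi : homeo M' M'')
    (phi : homeo M M') (f : mfield F M''),
    pull_m F (homeo_comp psi phi) f = pull_m F phi (pull_m F psi f);
  pull_res_bb : forall (M0 N0 M0' N0' M N M' N' : manifold)
    (W0 : bordism M0 N0) (W0' : bordism M0' N0') (W : bordism M N)
    (W' : bordism M' N') (j : subbordism W0 W) (j' : subbordism W0' W')
    (phi0 : bordismHomeo W0 W0') (phi : bordismHomeo W W'),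
    (forall x, phi (j x) = j' (phi0 x)) -> forall f : bfield F W',
    res_bb F j (pull_b F phi f) = pull_b F phi0 (res_bb F j' f);
  pull_res_bm : forall (M0 M0' M N M' N' : manifold) (W : bordism M N)
    (W' : bordism M' N') (j : submanifold M0 W) (j' : submanifold M0' W')
    (phi0 : homeo M0 M0') (phi : bordismHomeo W W'),
    (forall x, phi (j x) = j' (phi0 x)) -> forall f : bfield F W',
    res_bm F j (pull_b F phi f) = pull_m F phi0 (res_bm F j' f);
  pull_res_mm : forall (M0 M0' M M' : manifold)
    (j : submanifold M0 M) (j' : submanifold M0' M')
    (phi0 : homeo M0 M0') (phi : homeo M M'),
    (forall x, phi (j x) = j' (phi0 x)) -> forall f : mfield F M',
    res_mm F j (pull_m F phi f) = pull_m F phi0 (res_mm F j' f);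

  bfield_disj : forall (M N M' N' : manifold) (W : bordism M N)
    (W' : bordism M' N'), bijective (fun f : bfield F (disj_bordism W W') =>
      (res_bb F (left_subbordism W W') f, res_bb F (right_subbordism W W') f));
  mfield_disj : forall M N : manifold,
    bijective (fun f : mfield F (disj_manifold M N) =>
      (res_mm F (left_sub M N) f, res_mm F (right_sub M N) f));

  (* Bijectivity onto the pullback over [mfield F N]; that the restrictions of a
     field on [W] do land in the pullback follows from [res_bbm]. *)
  bfield_glue : forall (M N P : manifold) (W' : bordism M N)
    (W'' : bordism N P) (W : bordism M P) (g : gluing W' W'' W)
    (f' : bfield F W') (f'' : bfield F W''),
    res_bm F (out_sub W') f' = res_bm F (in_sub W'') f'' ->
    exists! f : bfield F W, res_bb F (gl_left_subbordism g) f = f' /\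
                            res_bb F (gl_right_subbordism g) f = f''
}.

Record fieldSystem := FieldSystem {
  fs_data :> fieldData;
  fs_axioms : isFieldSystem fs_data
}.

End Fields.

Arguments res_bb {R n} F {M0 N0 M N W0 W} j f : rename.
Arguments res_mm {R n} F {M0 M} j f : rename.
Arguments res_bm {R n} F {M0 M N W} j f : rename.
Arguments pull_b {R n} F {M N M' N' W W'} phi f : rename.
Arguments pull_m {R n} F {M M'} phi f : rename.

Definition isotopic_to_id (R : realType) (M : topologicalType)
    (phi : homeo M M) : Prop :=
  exists H : R -> homeo M M, [/\ H 0 =1 id, H 1 =1 phi &
    {within (`[0, 1] : set R) `*` [set: M],
      continuous (fun p : R * M => H p.1 p.2)}].

Section StateModules.
Context {R : realType} {n : nat} (F : fieldSystem R n).
Notation manifold := (closedManifold R n).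

Definition is_state (M : manifold) (T : Type) (z : mfield F M -> T) : Prop :=
  forall phi : homeo M M, isotopic_to_id R phi ->
  forall f : mfield F M, z (pull_m F phi f) = z f.

Definition state_pred (M : manifold) (T : Type) : {pred funSA (mfield F M) T} :=
  fun z => `[< is_state z >].

Definition stateSA (M : manifold) (T : Type) : Type :=
  {z : funSA (mfield F M) T | state_pred z}.

Section StateSemialgebra.
Context (M : manifold) (K : pzSemiRingType).

HB.instance Definition _ := [isSub of stateSA M K for @sval _ _].
HB.instance Definition _ := [Choice of stateSA M K by <:].

Let state_predP (z : funSA (mfield F M) K) :
  reflect (is_state z) (z \in @state_pred M K).
Proof. exact: asboolP. Qed.

Let state_semiring_closed : GRing.semiring_closed (@state_pred M K).
Proof.
split; split.
- by apply/state_predP => phi _ f.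
- move=> y z /state_predP sy /state_predP sz; apply/state_predP => phi iphi f.
  by congr (_ + _); [exact: sy|exact: sz].
- by apply/state_predP => phi _ f.
- move=> y z /state_predP sy /state_predP sz; apply/state_predP => phi iphi f.
  by congr (_ * _); [exact: sy|exact: sz].
Qed.

HB.instance Definition _ :=
  GRing.SubChoice_isSubPzSemiRing.Build (funSA (mfield F M) K) (@state_pred M K)
    (stateSA M K) state_semiring_closed.

Let lscale_closed (r : K) (z : stateSA M K) : @state_pred M K (lscale r (val z)).
Proof.
apply/state_predP => phi iphi f; congr (_ * _).
by have /state_predP := valP z; exact.
Qed.

Let rscale_closed (z : stateSA M K) (r : K) : @state_pred M K (rscale (val z) r).
Proof.
apply/state_predP => phi iphi f; congr (_ * _).
by have /state_predP := valP z; exact.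
Qed.

Let slscale (r : K) (z : stateSA M K) : stateSA M K :=
  exist _ (lscale r (val z)) (lscale_closed r z).
Let srscale (z : stateSA M K) (r : K) : stateSA M K :=
  exist _ (rscale (val z) r) (rscale_closed z r).

Let slscaleA a b v : slscale a (slscale b v) = slscale (a * b) v.
Proof. by apply: val_inj; exact: lscaleA. Qed.
Let srscaleA v a b : srscale (srscale v a) b = srscale v (a * b).
Proof. by apply: val_inj; exact: rscaleA. Qed.
Let slscale_rscaleA a v b : srscale (slscale a v) b = slscale a (srscale v b).
Proof. by apply: val_inj; exact: lscale_rscaleA. Qed.
Let slscale1 : left_id 1 slscale.
Proof. by move=> v; apply: val_inj; exact: lscale1. Qed.
Let srscale1 : right_id 1 srscale.
Proof. by move=> v; apply: val_inj; exact: rscale1. Qed.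
Let slscaleDr : right_distributive slscale +%R.
Proof. by move=> a v w; apply: val_inj; exact: lscaleDr. Qed.
Let srscaleDl : left_distributive srscale +%R.
Proof. by move=> v w a; apply: val_inj; exact: rscaleDl. Qed.
Let slscaleDl v : {morph slscale^~ v : a b / a + b}.
Proof. by move=> a b; apply: val_inj; exact: lscaleDl. Qed.
Let srscaleDr v : {morph srscale v : a b / a + b}.
Proof. by move=> a b; apply: val_inj; exact: rscaleDr. Qed.
Let slscale0 v : slscale 0 v = 0.
Proof. by apply: val_inj; exact: lscale0. Qed.
Let srscale0 v : srscale v 0 = 0.
Proof. by apply: val_inj; exact: rscale0. Qed.
Let slscaler0 a : slscale a 0 = 0.
Proof. by apply: val_inj; exact: lscaler0. Qed.
Let srscale0r a : srscale 0 a = 0.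
Proof. by apply: val_inj; exact: rscale0r. Qed.

HB.instance Definition _ := Nmodule_isBiSemiModule.Build K (stateSA M K)
  slscaleA srscaleA slscale_rscaleA slscale1 srscale1 slscaleDr srscaleDl
  slscaleDl srscaleDr slscale0 srscale0 slscaler0 srscale0r.

Let slscaleAl (r : K) (a b : stateSA M K) : lscale r (a * b) = lscale r a * b.
Proof. by apply: val_inj; exact: lscaleAl. Qed.
Let srscaleAr (a b : stateSA M K) (r : K) : rscale (a * b) r = a * rscale b r.
Proof. by apply: val_inj; exact: rscaleAr. Qed.

HB.instance Definition _ := BiSemiModule_isBiSemiAlgebra.Build K (stateSA M K)
  slscaleAl srscaleAr.

End StateSemialgebra.

Context (S : completePzSemiRingType) (C : strictMonoidalCat).

(* [prestate] and [state] are sets of functions into [Q S C]; the suffixes _c and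
   _m equip them with the structures coming from [Qc S C] and [Qm S C]. *)
Definition prestate (M : manifold) : Type := mfield F M -> Q S C.
Definition prestate_c (M : manifold) : biSemiAlgType (Qc S C) :=
  funSA (mfield F M) (Qc S C).
Definition prestate_m (M : manifold) : biSemiAlgType (Qm S C) :=
  funSA (mfield F M) (Qm S C).

Definition state (M : manifold) : Type := {z : prestate M | `[< is_state z >]}.
Definition state_c (M : manifold) : biSemiAlgType (Qc S C) :=
  stateSA M (Qc S C).
Definition state_m (M : manifold) : biSemiAlgType (Qm S C) :=
  stateSA M (Qm S C).

Definition push (M N : manifold) (phi : homeo M N) (z : prestate M) :
    prestate N :=
  fun g : mfield F N => z (pull_m F phi g).

Lemma push_isomorphism_c (M N : manifold) (phi : homeo M N) :
  biSemiAlg_isomorphism (push phi : prestate_c M -> prestate_c N).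
Proof. exact/funSA_isomorphism/(pull_m_bij (fs_axioms F)). Qed.

Lemma push_isomorphism_m (M N : manifold) (phi : homeo M N) :
  biSemiAlg_isomorphism (push phi : prestate_m M -> prestate_m N).
Proof. exact/funSA_isomorphism/(pull_m_bij (fs_axioms F)). Qed.

End StateModules.

(* Main.v *)
Require Import Defs.
From mathcomp Require Import all_boot all_order all_algebra.
From mathcomp Require Import all_classical reals topology normedtype.

Set Implicit Arguments.
Unset Strict Implicit.
Unset Printing Implicit Defensive.

(** Conjugation by [phi] turns a homeomorphism [psi] of [N] isotopic to the
    identity into the homeomorphism [phi^-1 \o psi \o phi] of [M], and an isotopy
    from the identity to [psi] into one from the identity to the conjugate
    ([isotopic_to_id_conj]).  Since [psi \o phi] equals [phi] composed with this
    conjugate, functoriality of the pullback of fields shows that a function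
    that defines a state of [M] is pushed forward to one that defines a state
    of [N] ([is_state_push]).  So [push phi] maps states to
    states, and so does the push-forward along the inverse of [phi]; by
    functoriality again these two maps are mutually inverse
    ([push_state_symK]).  All operations on functions on the set of fields are
    pointwise, hence preserved by any precomposition, whatever the semiring of
    values; so one argument covers both multiplications on [Q]
    ([push_state_isomorphism]). *)

(** The inverse of a homeomorphism is determined by the underlying map.  Fields
    are pulled back along the whole record, so pointwise identities between
    composites have to be turned into equalities of homeomorphisms. *)
Lemma homeo_ext (X Y : topologicalType) (f g : homeo X Y) : f =1 g -> f = g.
Proof.
case: f g => [f f' fK f'K fc f'c] [g g' gK g'K gc g'c] /= /funext fg.
have fg' : f' = g' by apply/funext => y; rewrite -{1}[y]g'K -fg fK.
by subst g g'; congr Homeo; exact: Prop_irrelevance.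
Qed.

Definition homeo_conj (X Y : topologicalType) (phi : homeo X Y)
    (psi : homeo Y Y) : homeo X X :=
  homeo_comp (homeo_sym phi) (homeo_comp psi phi).

Lemma homeo_comp_conj (X Y : topologicalType) (phi : homeo X Y)
    (psi : homeo Y Y) :
  homeo_comp phi (homeo_conj phi psi) = homeo_comp psi phi.
Proof. by apply: homeo_ext => x /=; rewrite homeo_invK. Qed.

Lemma homeo_comp_sym (X Y : topologicalType) (phi : homeo X Y) :
  homeo_comp (homeo_sym phi) phi = homeo_id X.
Proof. by apply: homeo_ext => x /=; rewrite homeo_funK. Qed.

(** Each stage of the isotopy is conjugated by [phi]. *)
Lemma isotopic_to_id_conj (R : realType) (X Y : topologicalType)
    (phi : homeo X Y) (psi : homeo Y Y) :
  isotopic_to_id R psi -> isotopic_to_id R (homeo_conj phi psi).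
Proof.
move=> [H [H0 H1 cH]]; exists (fun t => homeo_conj phi (H t)); split.
- by move=> x /=; rewrite H0 homeo_funK.
- by move=> x /=; rewrite H1.
(* The conjugated isotopy is [phi^-1 \o H \o (id * phi)], and [id * phi] maps
   the domain of the isotopy of [X] into that of the isotopy of [Y]. *)
apply/subspace_continuousP => -[t x] /= tx.
move/subspace_continuousP: cH => /(_ (t, phi x) tx) /= cH.
apply: (@cvg_comp _ _ _ (fun p : R * X => H p.1 (phi p.2)) (homeo_inv phi));
  last exact: homeo_inv_continuous.
apply: (@cvg_comp _ _ _ (fun p : R * X => (p.1, phi p.2))
  (fun q : R * Y => H q.1 q.2)) cH => B.
move=> [[U V] /= [Ut Vx] UVB]; exists (U, phi @^-1` V)%classic => /=.
  by split=> //; exact: (@homeo_continuous _ _ phi x).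
by move=> p /= [Up Vp] p01; exact: (UVB (p.1, phi p.2)).
Qed.

Section PushState.
Context (R : realType) (n : nat) (F : fieldSystem R n).
Notation manifold := (closedManifold R n).

(** For [psi] isotopic to the identity of [N] and [psi'] its conjugate,
    [phi^* (psi^* g) = psi'^* (phi^* g)], and [z] does not see [psi'^*]. *)
Lemma is_state_push (M N : manifold) (phi : homeo M N) (T : Type)
    (z : mfield F M -> T) :
  is_state z -> is_state (z \o pull_m F phi).
Proof.
have pullD := pull_m_comp (fs_axioms F).
move=> sz psi ipsi g /=.
by rewrite -pullD -homeo_comp_conj pullD; exact/sz/isotopic_to_id_conj.
Qed.

Definition push_state (M N : manifold) (phi : homeo M N) (T : Type)
    (z : stateSA F M T) : stateSA F N T :=
  exist _ (sval z \o pull_m F phi)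
    (asboolT (is_state_push phi (asboolW (svalP z)))).

Lemma push_state_symK (M N : manifold) (phi : homeo M N) (T : Type) :
  cancel (@push_state M N phi T) (@push_state N M (homeo_sym phi) T).
Proof.
move=> [z sz]; apply: eq_exist; apply/funext => f /=.
by rewrite -(pull_m_comp (fs_axioms F)) homeo_comp_sym (pull_m_id (fs_axioms F)).
Qed.

Lemma push_state_morphism (M N : manifold) (phi : homeo M N)
    (K : pzSemiRingType) :
  biSemiAlg_morphism (@push_state M N phi K).
Proof.
by split; [split=> [|y z]|split=> [|y z]|move=> r z|move=> z r]; exact: eq_exist.
Qed.

Lemma push_state_isomorphism (M N : manifold) (phi : homeo M N)
    (K : pzSemiRingType) :
  biSemiAlg_isomorphism (@push_state M N phi K).
Proof.
split; first exact: push_state_morphism.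
exists (@push_state N M (homeo_sym phi) K); split.
- exact: push_state_morphism.
- exact: push_state_symK.
- have -> : phi = homeo_sym (homeo_sym phi) by exact: homeo_ext.
  exact: push_state_symK.
Qed.

End PushState.

Theorem lemma6p6 (R : realType) (n : nat) (S : completePzSemiRingType)
    (C : strictMonoidalCat) (F : fieldSystem R n) (M N : closedManifold R n)
    (phi : homeo M N) :
  exists phiZ : state F S C M -> state F S C N,
    [/\ forall z : state F S C M, sval (phiZ z) = push phi (sval z),
        biSemiAlg_isomorphism (phiZ : state_c F S C M -> state_c F S C N) &
        biSemiAlg_isomorphism (phiZ : state_m F S C M -> state_m F S C N)].
Proof.
(* [Qc S C] and [Qm S C] share the carrier [Q S C], so a single map serves for
   both structures. *)
exists (push_state phi (T := Q S C)); split=> //.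
- exact: (push_state_isomorphism F phi (Qc S C)).
- exact: (push_state_isomorphism F phi (Qm S C)).
Qed.
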